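(* Assume $\mathcal Y\neq\emptyset$, $A$ has full row rank $m$, $Z^TQZ\succ 0$, the quadratic program has an optimal solution $y^*$ with multipliers $\lambda^*$ for the bound constraints, and the matrix $[R\;\;E^*]$ has full column rank. Let $w^0,\lambda^0$ be the initial iterates for the ADMM iteration. Then for all $k\ge0$, $$\|v^{k+1}-v^*\|\le\delta^G\,\|v^k-v^*\|,$$ $$\big\|(w^{k+2},\lambda^{k+2})-(y^*,\lambda^*/\beta)\big\|\le\delta^G\,\big\|(w^{k},\lambda^{k})-(y^*,\lambda^*/\beta)\big\|,$$ where $$\delta^G=\max\Big(\delta(\|M_Z\|,c_F^*,1),\ \delta\big(\|M_Z\|,1,\alpha^{\max}(\Delta^0)\big)\Big),\qquad \Delta^0=\|v^0-v^*\|.$$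
   Context: Problem. Let $Q\in\mathbb R^{n\times n}$ be symmetric positive semidefinite, $q\in\mathbb R^n$, $A\in\mathbb R^{m\times n}$, $b\in\mathbb R^m$, and $\mathcal Y=\{y\in\mathbb R^n:\underline y_i\le y_i\le\overline y_i\ \forall i\}$ with $-\infty\le\underline y_i<\overline y_i\le\infty$. The quadratic program (QP) is: minimize $q^Ty+\frac12 y^TQy$ subject to $Ay=b$, $y\in\mathcal Y$. Norms are Euclidean norms of vectors and spectral norms of matrices (the norm of a matrix with no columns is $0$); $(x,y)$ denotes vertical stacking of vectors. Notation. $\lambda\perp x\in\mathcal Y$ means $x\in\mathcal Y$ and $\lambda^T(x'-x)\ge0$ for all $x'\in\mathcal Y$. $R\in\mathbb R^{n\times m}$ and $Z\in\mathbb R^{n\times(n-m)}$ have columns forming orthonormal bases of the range of $A^T$ and of the null space of $A$. $\mathbb P_{\mathcal Y}$ is Euclidean projection onto $\mathcal Y$. Fix $\beta>0$, put $\tilde q=q/\beta$ and $$M=Z\big(Z^T(Q/\beta+I_n)Z\big)^{-1}Z^T,\quad N=(I_n-MQ/\beta)R(AR)^{-1},\quad M_Z=2(Z^TQZ/\beta+I_{n-m})^{-1}-I_{n-m}.$$ ADMM iteration, from arbitrary $w^0,\lambda^0\in\mathbb R^n$, for $k\ge0$: $y^{k+1}=M(w^k+\lambda^k-\tilde q)+Nb$, $w^{k+1}=\mathbb P_{\mathcal Y}(y^{k+1}-\lambda^k)$, $\lambda^{k+1}=\lambda^k+w^{k+1}-y^{k+1}$. Put $v^k=y^{k+1}-\lambda^k$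 for $k\ge 0$. Solution. $y^*$ is an optimal solution with multipliers $\lambda^*\in\mathbb R^n$ for the bound constraints if for some $\xi^*\in\mathbb R^m$: $Qy^*+A^T\xi^*-\lambda^*=-q$, $Ay^*=b$, $\lambda^*\perp y^*\in\mathcal Y$. Put $v^*=y^*-\lambda^*/\beta$. $\mathcal A^*=\{i: y_i^*=\underline y_i\text{ or }y_i^*=\overline y_i\}$; $E^*$ is the matrix whose columns are the unit vectors $e_i$, $i\in\mathcal A^*$; $c_F^*=\|R^TE^*\|$. The function $\alpha^{\max}$. Put $\Delta y_i^*=\min(y_i^*-\underline y_i,\overline y_i-y_i^* )$ and $\Delta y^*_{\min}=\min_{i\notin\mathcal A^*}\Delta y_i^*$ ($=+\infty$ if no $i\notin\mathcal A^*$ has a finite bound). Then $\alpha^{\max}(\Delta)=\sqrt{1-(\Delta y^*_{\min}/\Delta)^2}$ if $\Delta\ge\Delta y^*_{\min}$, and $\alpha^{\max}(\Delta)=0$ otherwise. Contraction factor. For $\kappa\ge 0$, $c\in[0,1]$, $\alpha^{\max}\in[0,1]$, $\delta(\kappa,c,\alpha^{\max})\ge0$ is defined by $$\delta(\kappa,c,\alpha^{\max})^2=\sup_{\zeta_u,\zeta_v,\alpha,\gamma}\ \tfrac14\big((\kappa\zeta_u+\zeta_v)^2+\gamma^2\big)$$ subject to $(\zeta_u+\zeta_v)^2\ge4(1-c^2)\alpha^2$, $\gamma^2\le4c^2\alpha^2$, $\gamma^2\le\big(\sqrt{1-\zeta_u^2}+\sqrt{1-\zeta_v^2}\big)^2$,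 $0\le\zeta_u,\zeta_v\le1$, $0\le\alpha\le\alpha^{\max}$. *)

(* Defs.v *)
From HB Require Import structures.
From mathcomp Require Import all_boot all_order all_algebra.
From mathcomp Require Import all_classical all_reals.

Set Implicit Arguments.
Unset Strict Implicit.
Unset Printing Implicit Defensive.

Import Order.TTheory GRing.Theory Num.Theory.

Local Open Scope classical_set_scope.
Local Open Scope ring_scope.

Section Norms.
Variable K : realType.

Definition dot (n : nat) (x y : 'cV[K]_n) : K := (x^T *m y) 0 0.

(* Euclidean norm; the library's norm on matrices is the maximum norm. *)
Definition enorm (n : nat) (x : 'cV[K]_n) : K :=
  Num.sqrt (\sum_(i < n) x i 0 ^+ 2).

(* The set always contains 0, so a matrix with no columns has norm 0. *)
Definition specnorm (m n : nat) (B : 'M[K]_(m, n)) : K :=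
  sup [set r : K | exists2 x : 'cV[K]_n, enorm x <= 1 & r = enorm (B *m x)].

Definition psdmx (n : nat) (B : 'M[K]_n) : Prop :=
  forall x : 'cV[K]_n, 0 <= dot x (B *m x).

Definition pdmx (n : nat) (B : 'M[K]_n) : Prop :=
  forall x : 'cV[K]_n, x != 0 -> 0 < dot x (B *m x).

(* The columns of B form an orthonormal basis of the row space of C,
   viewed as a space of column vectors. *)
Definition orthonormal_basis (n r p : nat)
    (B : 'M[K]_(n, r)) (C : 'M[K]_(p, n)) : Prop :=
  B^T *m B = 1%:M /\ (B^T == C)%MS.

End Norms.

Section Problem.
Variables (K : realType) (n : nat).

Definition box (lo hi : 'I_n -> \bar K) : set 'cV[K]_n :=
  [set y | forall i, (lo i <= (y i 0)%:E <= hi i)%E].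

Definition perp (Y : set 'cV[K]_n) (lam x : 'cV[K]_n) : Prop :=
  Y x /\ forall x', Y x' -> 0 <= dot lam (x' - x).

(* A nearest point of Y to x (it exists and is unique for Y nonempty, closed
   and convex); 0 is returned if there is none. *)
Definition euclidean_proj (Y : set 'cV[K]_n) (x : 'cV[K]_n) : 'cV[K]_n :=
  xget 0 [set p | Y p /\ forall y, Y y -> enorm (x - p) <= enorm (x - y)].

Definition optimal_with_multipliers (m : nat) (Q : 'M[K]_n) (q : 'cV[K]_n)
    (A : 'M[K]_(m, n)) (b : 'cV[K]_m) (Y : set 'cV[K]_n)
    (y lam : 'cV[K]_n) : Prop :=
  exists xi : 'cV[K]_m,
    [/\ Q *m y + A^T *m xi - lam = - q, A *m y = b & perp Y lam y].

Definition active (lo hi : 'I_n -> \bar K) (y : 'cV[K]_n) : {set 'I_n} :=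
  [set i | ((y i 0)%:E == lo i) || ((y i 0)%:E == hi i)].

Definition unit_columns (S : {set 'I_n}) : 'M[K]_(n, #|S|) :=
  \matrix_(i < n, j < #|S|) (i == enum_val j)%:R.

Definition gap (lo hi : 'I_n -> \bar K) (y : 'cV[K]_n) (i : 'I_n) : \bar K :=
  Order.min ((y i 0)%:E - lo i)%E (hi i - (y i 0)%:E)%E.

Definition gap_min (lo hi : 'I_n -> \bar K) (y : 'cV[K]_n) : \bar K :=
  \big[Order.min/+oo%E]_(i | i \notin active lo hi y) gap lo hi y i.

(* For y in the box, gap_min is positive, hence a positive real whenever it is
   at most D. *)
Definition alpha_max (lo hi : 'I_n -> \bar K) (y : 'cV[K]_n) (D : K) : K :=
  if (gap_min lo hi y <= D%:E)%E
  then Num.sqrt (1 - (fine (gap_min lo hi y) / D) ^+ 2)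
  else 0.

End Problem.

Section Matrices.
Variables (K : realType) (m n : nat).
Variables (Q : 'M[K]_n) (A : 'M[K]_(m, n)) (beta : K).
Variables (R : 'M[K]_(n, m)) (Z : 'M[K]_(n, n - m)).

Definition M_mx : 'M[K]_n :=
  Z *m invmx (Z^T *m (beta^-1 *: Q + 1%:M) *m Z) *m Z^T.

Definition N_mx : 'M[K]_(n, m) :=
  (1%:M - M_mx *m (beta^-1 *: Q)) *m R *m invmx (A *m R).

Definition MZ_mx : 'M[K]_(n - m) :=
  2 *: invmx (beta^-1 *: (Z^T *m Q *m Z) + 1%:M) - 1%:M.

End Matrices.

Section Contraction.
Variable K : realType.

Definition delta_feasible (c amax zu zv a g : K) : Prop :=
  [/\ (zu + zv) ^+ 2 >= 4 * (1 - c ^+ 2) * a ^+ 2,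
      g ^+ 2 <= 4 * c ^+ 2 * a ^+ 2,
      g ^+ 2 <= (Num.sqrt (1 - zu ^+ 2) + Num.sqrt (1 - zv ^+ 2)) ^+ 2,
      0 <= zu <= 1 /\ 0 <= zv <= 1 &
      0 <= a <= amax].

(* The feasible set contains the origin and the objective is bounded on it, so
   the supremum is that of a nonempty bounded set. *)
Definition delta (kappa c amax : K) : K :=
  Num.sqrt (sup [set r : K | exists zu zv a g : K,
    delta_feasible c amax zu zv a g /\
    r = 4^-1 * ((kappa * zu + zv) ^+ 2 + g ^+ 2)]).

End Contraction.

(* Main.v *)
Require Import Defs.
From HB Require Import structures.
From mathcomp Require Import all_boot all_order all_algebra.
From mathcomp Require Import all_classical all_reals.
From mathcomp Require Import ring lra.

Set Implicit Arguments.
Unset Strict Implicit.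
Unset Printing Implicit Defensive.

Import Order.TTheory GRing.Theory Num.Theory.

Local Open Scope classical_set_scope.
Local Open Scope ring_scope.

(** Let [P] be the projection onto the box, [e = v - v*], [p = P v - P v*] and
[d = 2 p - e], the error after reflection.  The iteration gives
[e+ = M d + e - p], which splits orthogonally into
[Z^T e+ = (M_Z Z^T d + Z^T e) / 2] and [R^T e+ = R^T (e - p)].  Firm
nonexpansiveness of [P] gives [|d| <= |e|] and [|e - p|^2 + |p|^2 <= |e|^2], so
the norms of [Z^T d], [Z^T e], [e - p] and [2 R^T (e - p)], divided by [|e|], are
feasible for the optimization problem defining [delta] in one of two cases.  If no
coordinate inactive at [y*] is clipped, then [e - p] is supported on the active
set, which gives [c = c_F*].  Otherwise such a clipped coordinate of [p] is at
least the minimal gap, so that [|e - p| <= alpha_max |e|], and [c = 1].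
For the second bound, [|(w^(k+2), lam^(k+2)) - (y*, lam*/beta)| <= |e^(k+1)|]
again by firm nonexpansiveness of [P], and
[|e^k| <= |(w^k, lam^k) - (y*, lam*/beta)|] by that of [M]. *)

(** * Euclidean inner products, Euclidean and spectral norms, nearest points *)

Section EuclideanSpace.
Variable K : realType.
Implicit Types (m n : nat) (a : K).

Lemma dotE n (x y : 'cV[K]_n) : dot x y = \sum_i x i 0 * y i 0.
Proof. by rewrite /dot mxE; apply: eq_bigr => i _; rewrite mxE. Qed.

Lemma dotC n (x y : 'cV[K]_n) : dot x y = dot y x.
Proof. by rewrite !dotE; apply: eq_bigr => i _; rewrite mulrC. Qed.

Lemma dotDr n (x y z : 'cV[K]_n) : dot x (y + z) = dot x y + dot x z.
Proof. by rewrite /dot mulmxDr mxE. Qed.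

Lemma dotDl n (x y z : 'cV[K]_n) : dot (x + y) z = dot x z + dot y z.
Proof. by rewrite dotC dotDr !(dotC z). Qed.

Lemma dotZr n a (x y : 'cV[K]_n) : dot x (a *: y) = a * dot x y.
Proof. by rewrite /dot -scalemxAr mxE. Qed.

Lemma dotZl n a (x y : 'cV[K]_n) : dot (a *: x) y = a * dot x y.
Proof. by rewrite dotC dotZr dotC. Qed.

Lemma dotNr n (x y : 'cV[K]_n) : dot x (- y) = - dot x y.
Proof. by rewrite -scaleN1r dotZr mulN1r. Qed.

Lemma dotNl n (x y : 'cV[K]_n) : dot (- x) y = - dot x y.
Proof. by rewrite dotC dotNr dotC. Qed.

Definition dot_linE := (dotDl, dotDr, dotNl, dotNr, dotZl, dotZr).

Lemma dot_mulmxr m n (B : 'M[K]_(m, n)) (x : 'cV[K]_m) (y : 'cV[K]_n) :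
  dot x (B *m y) = dot (B^T *m x) y.
Proof. by rewrite /dot trmx_mul trmxK mulmxA. Qed.

Lemma dot_ge0 n (x : 'cV[K]_n) : 0 <= dot x x.
Proof. by rewrite dotE sumr_ge0 // => i _; rewrite -expr2 sqr_ge0. Qed.

Lemma dot_eq0 n (x : 'cV[K]_n) : (dot x x == 0) = (x == 0).
Proof.
apply/idP/eqP => [|->]; last by rewrite /dot mulmx0 mxE.
rewrite dotE psumr_eq0 => [/allP x0|i _]; last by rewrite -expr2 sqr_ge0.
apply/colP => i; rewrite mxE; apply/eqP.
by have := x0 i; rewrite mem_index_enum -expr2 sqrf_eq0; apply.
Qed.

Lemma enormE n (x : 'cV[K]_n) : enorm x = Num.sqrt (dot x x).
Proof. by rewrite dotE. Qed.

Lemma enorm_ge0 n (x : 'cV[K]_n) : 0 <= enorm x.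
Proof. exact: sqrtr_ge0. Qed.

Lemma sqr_enorm n (x : 'cV[K]_n) : enorm x ^+ 2 = dot x x.
Proof. by rewrite enormE sqr_sqrtr ?dot_ge0. Qed.

Lemma enorm_eq0 n (x : 'cV[K]_n) : (enorm x == 0) = (x == 0).
Proof. by rewrite -sqrf_eq0 sqr_enorm dot_eq0. Qed.

Lemma enorm_le m n (x : 'cV[K]_m) (y : 'cV[K]_n) :
  (enorm x <= enorm y) = (dot x x <= dot y y).
Proof. by rewrite -!sqr_enorm ler_sqr ?nnegrE ?enorm_ge0. Qed.

Lemma enormZ n a (x : 'cV[K]_n) : enorm (a *: x) = `|a| * enorm x.
Proof.
by rewrite !enormE dotZl dotZr mulrA -expr2 sqrtrM ?sqr_ge0 // sqrtr_sqr.
Qed.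

(** Cauchy-Schwarz, from the nonnegativity of the squared norm of [dot y y *: x - dot x y *: y]. *)
Lemma dot_le_enorm n (x y : 'cV[K]_n) : dot x y <= enorm x * enorm y.
Proof.
have [->|y0] := eqVneq y 0.
  by rewrite /dot mulmx0 mxE mulr_ge0 ?enorm_ge0.
have yy_gt0 : 0 < dot y y by rewrite lt0r dot_eq0 y0 dot_ge0.
rewrite (le_trans (ler_norm _)) // -ler_sqr ?nnegrE ?mulr_ge0 ?enorm_ge0 //.
rewrite real_normK ?num_real // exprMn !sqr_enorm -(ler_pM2l yy_gt0).
rewrite -subr_ge0 (le_trans (dot_ge0 (dot y y *: x - dot x y *: y))) //.
by rewrite !dot_linE (dotC y x) le_eqVlt; apply/orP; left; apply/eqP; ring.
Qed.

Lemma enormD n (x y : 'cV[K]_n) : enorm (x + y) <= enorm x + enorm y.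
Proof.
rewrite -ler_sqr ?nnegrE ?addr_ge0 ?enorm_ge0 //.
rewrite sqrrD !sqr_enorm !dot_linE (dotC y x) mulr2n.
by have := dot_le_enorm x y; lra.
Qed.

Lemma enormN n (x : 'cV[K]_n) : enorm (- x) = enorm x.
Proof. by rewrite !enormE dotNl dotNr opprK. Qed.

Lemma enormB n (x y : 'cV[K]_n) : enorm (x - y) <= enorm x + enorm y.
Proof. by rewrite (le_trans (enormD _ _)) // enormN. Qed.

Lemma dot_col_mx m n (x1 y1 : 'cV[K]_m) (x2 y2 : 'cV[K]_n) :
  dot (col_mx x1 x2) (col_mx y1 y2) = dot x1 y1 + dot x2 y2.
Proof. by rewrite /dot tr_col_mx mul_row_col mxE. Qed.

Lemma coord_le_enorm n (x : 'cV[K]_n) i : `|x i 0| <= enorm x.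
Proof.
rewrite -ler_sqr ?nnegrE ?enorm_ge0 // sqr_enorm real_normK ?num_real //.
rewrite dotE (bigD1 i) //= -expr2 lerDl sumr_ge0 // => j _.
by rewrite -expr2 sqr_ge0.
Qed.

(** Coordinates of the unit ball are at most 1 in absolute value, so the absolute row sums of [B]
    bound the image. This makes the [sup] in [specnorm] a genuine upper bound. *)
Lemma specnorm_bounded m n (B : 'M[K]_(m, n)) :
  has_ubound [set r : K | exists2 x : 'cV[K]_n, enorm x <= 1 & r = enorm (B *m x)].
Proof.
exists (Num.sqrt (\sum_i (\sum_j `|B i j|) ^+ 2)) => _ [x x1 ->].
apply: ler_wsqrtr; apply: ler_sum => i _.
rewrite -real_normK ?num_real // ler_sqr ?nnegrE ?sumr_ge0 //.
rewrite mxE (le_trans (ler_norm_sum _ _ _)) //; apply: ler_sum => j _.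
rewrite normrM ler_piMr // (le_trans _ x1) //; exact: coord_le_enorm.
Qed.

Lemma enorm_mulmx_le m n (B : 'M[K]_(m, n)) (x : 'cV[K]_n) :
  enorm (B *m x) <= specnorm B * enorm x.
Proof.
have [->|x0] := eqVneq x 0.
  have E p : enorm (0 : 'cV[K]_p) = 0 by apply/eqP; rewrite enorm_eq0.
  by rewrite mulmx0 !E mulr0.
have x_gt0 : 0 < enorm x by rewrite lt0r enorm_eq0 x0 enorm_ge0.
rewrite -ler_pdivrMr // mulrC -[_^-1]ger0_norm ?invr_ge0 ?enorm_ge0 //.
rewrite -enormZ scalemxAr; apply: ub_le_sup; first exact: specnorm_bounded.
exists ((enorm x)^-1 *: x) => //.
by rewrite enormZ ger0_norm ?invr_ge0 ?enorm_ge0 // mulVf // gt_eqF.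
Qed.

Lemma specnorm_ge0 m n (B : 'M[K]_(m, n)) : 0 <= specnorm B.
Proof.
apply: ub_le_sup; first exact: specnorm_bounded.
exists 0; last by apply/esym/eqP; rewrite enorm_eq0 mulmx0.
by rewrite (_ : enorm _ = 0) //; apply/eqP; rewrite enorm_eq0.
Qed.

(** A vector supported on [S] is [unit_columns K S *m g], where [g] lists its entries on [S] and has
    the same norm. With [B = R^T] this is how [c_F*] enters. *)
Lemma enorm_mulmx_unit_columns n p (S : {set 'I_n}) (B : 'M[K]_(p, n))
    (f : 'cV[K]_n) :
  (forall i, i \notin S -> f i 0 = 0) ->
  enorm (B *m f) <= specnorm (B *m unit_columns K S) * enorm f.
Proof.
move=> fS; pose g : 'cV[K]_#|S| := \col_j f (enum_val j) 0.
have sumS (F : 'I_n -> K) : (forall i, i \notin S -> F i = 0) ->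
    \sum_i F i = \sum_(j < #|S|) F (enum_val j).
  move=> FS; transitivity (\sum_(i in S) F i); last exact: big_enum_val.
  by rewrite [RHS]big_mkcond; apply: eq_bigr => i _; case: ifPn => // /FS.
have fE : f = unit_columns K S *m g.
  apply/colP => i; rewrite mxE.
  under eq_bigr do rewrite !mxE.
  rewrite -(sumS (fun k => (i == k)%:R * f k 0)).
    by rewrite (bigD1 i) //= eqxx mul1r big1 ?addr0 // => j /negPf;
       rewrite eq_sym => ->; rewrite mul0r.
  by move=> k /fS ->; rewrite mulr0.
have -> : enorm f = enorm g.
  rewrite /enorm (sumS (fun i => f i 0 ^+ 2)).
    by congr Num.sqrt; apply: eq_bigr => j _; rewrite mxE.
  by move=> k /fS ->; rewrite expr0n.
by rewrite {1}fE mulmxA enorm_mulmx_le.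
Qed.

(** The variational inequality gives [|x - z|^2 >= |x - p|^2 + |z - p|^2] on [Y], so [p] is the only
    nearest point and [xget] must return it. *)
Lemma euclidean_proj_eq n (Y : set 'cV[K]_n) (x p : 'cV[K]_n) : Y p ->
  (forall z, Y z -> dot (x - p) (z - p) <= 0) -> euclidean_proj Y x = p.
Proof.
move=> Yp VI.
have key z : dot (x - z) (x - z) =
    dot (x - p) (x - p) + dot (z - p) (z - p) - 2 * dot (x - p) (z - p).
  by rewrite !dot_linE !(dotC p x) !(dotC z x) !(dotC z p); ring.
have near z : Y z -> enorm (x - p) <= enorm (x - z).
  by move=> Yz; rewrite enorm_le (key z); have := VI z Yz; have := dot_ge0 (z - p); lra.
rewrite /euclidean_proj; case: xgetP => [p' _ [Yp' min']|/(_ p) []//].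
apply/eqP; rewrite -subr_eq0 -dot_eq0 eq_le dot_ge0 andbT.
by have := min' _ Yp; rewrite enorm_le (key p'); have := VI _ Yp'; lra.
Qed.

End EuclideanSpace.

(** * Projection onto the box: coordinatewise clipping, firm nonexpansiveness, gaps *)

Section BoxProjection.
Variable K : realType.

(** The claim is the sum of the two hypotheses, rearranged. *)
Lemma firm_of_variational n (x x' p p' : 'cV[K]_n) :
  dot (x - p) (p' - p) <= 0 -> dot (x' - p') (p - p') <= 0 ->
  dot (p - p') (p - p') <= dot (p - p') (x - x').
Proof.
rewrite !dot_linE !(dotC x p) !(dotC x p') !(dotC x' p) !(dotC x' p') !(dotC p' p).
lra.
Qed.

(** When [l < h], the strict tests ensure that [fine] is only applied to a finite bound. *)
Definition clip (l h : \bar K) (x : K) : K :=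
  if (x%:E < l)%E then fine l else if (h < x%:E)%E then fine h else x.

Lemma lower_fineK (l h : \bar K) x : (l < h)%E -> (x%:E < l)%E ->
  (fine l)%:E = l.
Proof.
move=> lh xl; rewrite fineK // fin_numElt (lt_trans _ xl) ?ltNyr //=.
by rewrite (lt_le_trans lh) ?leey.
Qed.

Lemma upper_fineK (l h : \bar K) x : (l < h)%E -> (h < x%:E)%E ->
  (fine h)%:E = h.
Proof.
move=> lh hx; rewrite fineK // fin_numElt (lt_trans hx) ?ltry // andbT.
by rewrite (le_lt_trans _ lh) ?leNye.
Qed.

Lemma clip_between (l h : \bar K) x : (l < h)%E ->
  (l <= (clip l h x)%:E <= h)%E.
Proof.
move=> lh; rewrite /clip; case: ifPn => [xl|].
  by rewrite (lower_fineK lh xl) lexx ltW.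
rewrite -leNgt => lx; case: ifPn => [hx|]; last by rewrite -leNgt lx.
by rewrite (upper_fineK lh hx) lexx ltW.
Qed.

Lemma clip_variational (l h : \bar K) x t : (l < h)%E ->
  (l <= t%:E <= h)%E -> (x - clip l h x) * (t - clip l h x) <= 0.
Proof.
move=> lh /andP[lt th]; rewrite /clip; case: ifPn => [xl|_].
  have lE := lower_fineK lh xl.
  have x_le : x <= fine l by rewrite -lee_fin lE ltW.
  have le_t : fine l <= t by rewrite -lee_fin lE.
  by rewrite mulr_le0_ge0 ?subr_ge0 ?subr_le0.
case: ifPn => [hx|_]; last by rewrite subrr mul0r.
have hE := upper_fineK lh hx.
have le_x : fine h <= x by rewrite -lee_fin hE ltW.
have t_le : t <= fine h by rewrite -lee_fin hE.
by rewrite mulr_ge0_le0 ?subr_ge0 ?subr_le0.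
Qed.

Variables (n : nat) (lo hi : 'I_n -> \bar K).
Hypothesis lo_lt_hi : forall i, (lo i < hi i)%E.

(** The variational inequality holds coordinate by coordinate, hence after summation. *)
Lemma euclidean_proj_box x :
  euclidean_proj (box lo hi) x = \col_i clip (lo i) (hi i) (x i 0).
Proof.
apply: euclidean_proj_eq => [i|z boxz]; first by rewrite mxE clip_between.
rewrite dotE; apply: sumr_le0 => i _; rewrite !mxE.
exact: clip_variational (boxz i).
Qed.

Lemma euclidean_proj_boxP x : let p := euclidean_proj (box lo hi) x in
  box lo hi p /\ forall z, box lo hi z -> dot (x - p) (z - p) <= 0.
Proof.
rewrite /= euclidean_proj_box; split=> [i|z boxz].
  by rewrite mxE clip_between.
rewrite dotE; apply: sumr_le0 => i _; rewrite !mxE.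
exact: clip_variational (boxz i).
Qed.

Lemma euclidean_proj_box_firm x x' :
  let p := euclidean_proj (box lo hi) x in
  let p' := euclidean_proj (box lo hi) x' in
  dot (p - p') (p - p') <= dot (p - p') (x - x').
Proof.
have [boxp VI] := euclidean_proj_boxP x.
have [boxp' VI'] := euclidean_proj_boxP x'.
by apply: firm_of_variational; [apply: VI | apply: VI'].
Qed.

Lemma notin_active (z : 'cV[K]_n) i : box lo hi z -> i \notin active lo hi z ->
  (lo i < (z i 0)%:E < hi i)%E.
Proof.
move=> /(_ i) /andP[lz zh]; rewrite inE negb_or => /andP[nl nh].
by rewrite !lt_neqAle lz zh nh eq_sym nl.
Qed.

Lemma gap_min_le (z : 'cV[K]_n) i : i \notin active lo hi z ->
  (gap_min lo hi z <= gap lo hi z i)%E.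
Proof. by move=> iA; rewrite /gap_min (bigD1 i) //= ge_min lexx. Qed.

Lemma gap_min_ge0 (z : 'cV[K]_n) : box lo hi z -> (0 <= gap_min lo hi z)%E.
Proof.
move=> boxz; rewrite /gap_min; elim/big_ind: _ => [|u v u0 v0|i _].
- exact: leey.
- by rewrite le_min u0 v0.
have /andP[lz zh] := boxz i; rewrite /gap le_min.
by apply/andP; split; rewrite sube_ge0 //; rewrite fin_numE ?orbT.
Qed.

(** A clipped coordinate of [p] lies on a bound, so its distance to [p' i 0] is at least the gap of
    [p'] at [i]. *)
Lemma gap_min_le_enorm x x' i :
  let p := euclidean_proj (box lo hi) x in
  let p' := euclidean_proj (box lo hi) x' in
  i \notin active lo hi p' -> p i 0 != x i 0 ->
  (gap_min lo hi p' <= (enorm (p - p'))%:E)%E.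
Proof.
move=> p p' iA px.
have [boxp' _] := euclidean_proj_boxP x'.
apply: (le_trans (gap_min_le iA)).
suff : (gap lo hi p' i <= `|(p - p') i 0|%:E)%E.
  by move=> /le_trans; apply; rewrite lee_fin coord_le_enorm.
have /andP[] := notin_active boxp' iA.
move: px; rewrite /gap [(p - p') i 0]mxE [(- p') i 0]mxE.
rewrite [p]euclidean_proj_box mxE /clip.
case: ifPn => [xl _ _ _|_].
  rewrite ge_min; apply/orP; left.
  by rewrite -{1}(lower_fineK (lo_lt_hi i) xl) -EFinB lee_fin distrC ler_norm.
case: ifPn => [hx _ _ _|]; last by rewrite eqxx.
rewrite ge_min; apply/orP; right.
by rewrite -{1}(upper_fineK (lo_lt_hi i) hx) -EFinB lee_fin ler_norm.
Qed.

Lemma proj_notin_active x i : let p := euclidean_proj (box lo hi) x in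
  i \notin active lo hi p -> p i 0 = x i 0.
Proof.
move=> p iA; have /andP[] := notin_active (euclidean_proj_boxP x).1 iA.
rewrite -/p [p]euclidean_proj_box mxE /clip.
case: ifPn => [xl|_]; first by rewrite (lower_fineK (lo_lt_hi i) xl) ltxx.
by case: ifPn => // hx; rewrite (upper_fineK (lo_lt_hi i) hx) ltxx.
Qed.

End BoxProjection.

(** * Lower bounds on the contraction factor from feasible points *)

Section ContractionFactor.
Variable K : realType.
Implicit Types kappa c amax : K.

Lemma delta_ge0 kappa c amax : 0 <= delta kappa c amax.
Proof. exact: sqrtr_ge0. Qed.

Lemma le_delta kappa c amax zu zv a g : 0 <= kappa ->
  delta_feasible c amax zu zv a g ->
  4^-1 * ((kappa * zu + zv) ^+ 2 + g ^+ 2) <= delta kappa c amax ^+ 2.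
Proof.
move=> k0 feas.
set E := [set r : K | exists zu zv a g : K, delta_feasible c amax zu zv a g /\
    r = 4^-1 * ((kappa * zu + zv) ^+ 2 + g ^+ 2)].
have E_r : E (4^-1 * ((kappa * zu + zv) ^+ 2 + g ^+ 2)) by exists zu, zv, a, g.
suff ubE : has_ubound E.
  have le_sup := ub_le_sup ubE E_r.
  rewrite sqr_sqrtr //; apply: le_trans le_sup.
  by rewrite mulr_ge0 ?addr_ge0 ?sqr_ge0 // invr_ge0.
(* Feasibility gives [zu, zv <= 1], and both square roots bounding [g] are at most 1. *)
exists (4^-1 * ((kappa + 1) ^+ 2 + 2 ^+ 2)).
move=> _ [zu' [zv' [a' [g' [[_ _ hg [/andP[u0 u1] /andP[v0 v1]] _] ->]]]]].
rewrite ler_pM2l ?invr_gt0 //; apply: lerD.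
  by rewrite ler_sqr ?nnegrE ?addr_ge0 ?mulr_ge0 // lerD // ler_piMr.
apply: (le_trans hg); rewrite ler_sqr ?nnegrE ?addr_ge0 ?sqrtr_ge0 //.
have sqrt_le1 (t : K) : Num.sqrt (1 - t ^+ 2) <= 1.
  by rewrite -[leRHS]sqrtr1 ler_wsqrtr // gerBl sqr_ge0.
by rewrite (_ : 2 = 1 + 1 :> K) // lerD.
Qed.

(** Constraints and objective are homogeneous of degree 2 once the bounds 1 become [rho]; dividing
    all variables by [rho] gives a feasible point. It is applied with [rho = |e|]. *)
Lemma le_delta_scaled kappa c amax rho zu zv a g : 0 <= kappa -> 0 < rho ->
  4 * (1 - c ^+ 2) * a ^+ 2 <= (zu + zv) ^+ 2 ->
  g ^+ 2 <= 4 * c ^+ 2 * a ^+ 2 ->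
  0 <= g <= Num.sqrt (rho ^+ 2 - zu ^+ 2) + Num.sqrt (rho ^+ 2 - zv ^+ 2) ->
  0 <= zu <= rho -> 0 <= zv <= rho -> 0 <= a <= amax * rho ->
  4^-1 * ((kappa * zu + zv) ^+ 2 + g ^+ 2) <= (delta kappa c amax * rho) ^+ 2.
Proof.
move=> k0 rho0 h1 h2 /andP[g0 hg] /andP[u0 u1] /andP[v0 v1] /andP[a0 a1].
have rho_ge0 := ltW rho0.
have rhoN0 : rho != 0 by rewrite gt_eqF.
have rho2 : 0 < rho ^+ 2 by rewrite exprn_gt0.
have sqrt_scale z : Num.sqrt (rho ^+ 2 - z ^+ 2) =
    rho * Num.sqrt (1 - (z / rho) ^+ 2).
  rewrite -[X in X * _](ger0_norm rho_ge0) -sqrtr_sqr -sqrtrM ?sqr_ge0 //.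
  by congr Num.sqrt; field.
have feas : delta_feasible c amax (zu / rho) (zv / rho) (a / rho) (g / rho).
  split.
  - rewrite -mulrDl !expr_div_n mulrA ler_pM2r ?invr_gt0 //.
  - by rewrite !expr_div_n mulrA ler_pM2r ?invr_gt0 //.
  - rewrite ler_sqr ?nnegrE ?addr_ge0 ?sqrtr_ge0 ?divr_ge0 //.
    by rewrite ler_pdivrMr // mulrC mulrDr -!sqrt_scale.
  - by rewrite !divr_ge0 // !ler_pdivrMr // !mul1r u1 v1.
  - by rewrite divr_ge0 // ler_pdivrMr.
have := le_delta k0 feas; rewrite -(ler_pM2r rho2) -exprMn; apply: le_trans.
by rewrite le_eqVlt; apply/orP; left; apply/eqP; field.
Qed.

End ContractionFactor.

(** * Orthogonal splitting into the row space and the null space of [A] *)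

Section OrthonormalSplitting.
Variables (K : realType) (m n : nat) (A : 'M[K]_(m, n)).
Variables (R : 'M[K]_(n, m)) (Z : 'M[K]_(n, n - m)).
Hypothesis A_full_row_rank : \rank A = m.
Hypothesis R_basis : orthonormal_basis R A.
Hypothesis Z_basis : orthonormal_basis Z (kermx A^T).

Lemma mulmx_A_Z : A *m Z = 0.
Proof.
have /andP[/submxP[D ZE] _] := Z_basis.2.
by rewrite -[A *m Z]trmxK trmx_mul ZE -mulmxA mulmx_ker mulmx0 trmx0.
Qed.

Lemma mulmx_RT_Z : R^T *m Z = 0.
Proof.
have /andP[/submxP[D ->] _] := R_basis.2.
by rewrite -mulmxA mulmx_A_Z mulmx0.
Qed.

Lemma orthonormal_splitting : R *m R^T + Z *m Z^T = 1%:M.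
Proof.
(* Full row rank gives [m <= n], so the truncated subtraction is exact. *)
have mn : (m + (n - m) = n)%N.
  by rewrite subnKC // -A_full_row_rank rank_leq_col.
pose W := row_mx R Z.
have WTW : W^T *m W = 1%:M.
  rewrite /W tr_row_mx mul_col_row R_basis.1 Z_basis.1 mulmx_RT_Z.
  by rewrite -[Z^T *m R]trmxK trmx_mul trmxK mulmx_RT_Z trmx0 -scalar_mx_block.
have W_free : row_free W.
  rewrite /row_free eqn_leq rank_leq_row /=.
  by have := mxrankM_maxr W^T W; rewrite WTW mxrank1; apply: leq_trans; rewrite mn.
rewrite -mul_row_col -tr_row_mx -/W.
(* The type of [W] is not syntactically square, so [W W^T = 1] is obtained by cancelling [W] on the
   right in [W W^T W = W]. *)
by apply: (row_free_inj W_free); rewrite -mulmxA WTW mulmx1 mul1mx.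
Qed.

Lemma orthonormal_decomp (x : 'cV[K]_n) : R *m (R^T *m x) + Z *m (Z^T *m x) = x.
Proof. by rewrite !mulmxA -mulmxDl orthonormal_splitting mul1mx. Qed.

Lemma dot_splitting (x : 'cV[K]_n) :
  dot x x = dot (R^T *m x) (R^T *m x) + dot (Z^T *m x) (Z^T *m x).
Proof.
by rewrite -!dot_mulmxr -dotDr orthonormal_decomp.
Qed.

(** Writing [R^T = D A] gives the left inverse [D] of the square matrix [A R]. *)
Lemma AR_unit : A *m R \in unitmx.
Proof.
have /andP[/submxP[D RE] _] := R_basis.2.
by apply: (proj2 (mulmx1_unit (_ : D *m (A *m R) = 1%:M)));
  rewrite mulmxA -RE R_basis.1.
Qed.

End OrthonormalSplitting.

(** * Invertibility behind the resolvent of a positive semidefinite matrix *)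

Section Resolvent.
Variables (K : realType) (n : nat) (S : 'M[K]_n).
Hypothesis S_psd : psdmx S.

Lemma psd_add1_unit : S + 1%:M \in unitmx.
Proof.
(* The determinant criterion yields a null row vector, hence the transposition. For such [v] the
   form [v S v^T + |v|^2] vanishes, which forces [v = 0]. *)
rewrite -unitmx_tr unitmxE unitfE; apply/det0P => -[v v0 vS].
suff: v^T == 0 by rewrite -trmx0 (inj_eq trmx_inj) (negPf v0).
rewrite -dot_eq0 eq_le dot_ge0 andbT.
have : dot v^T ((S + 1%:M) *m v^T) = 0.
  by rewrite -[S + _]trmxK -trmx_mul vS trmx0 /dot mulmx0 mxE.
by rewrite mulmxDl mul1mx dotDr; have := S_psd v^T; lra.
Qed.

End Resolvent.

Lemma firm_pythagoras (K : realType) n (e p : 'cV[K]_n) :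
  dot p p <= dot p e -> dot (e - p) (e - p) + dot p p <= dot e e.
Proof. by rewrite !dot_linE !(dotC e p); lra. Qed.

(** * The matrix [M], the fixed point, and the error recursion *)

Section Iteration.
Variables (K : realType) (m n : nat).
Variables (Q : 'M[K]_n) (q : 'cV[K]_n) (A : 'M[K]_(m, n)) (b : 'cV[K]_m).
Variables (R : 'M[K]_(n, m)) (Z : 'M[K]_(n, n - m)) (beta : K).
Hypothesis Qpsd : psdmx Q.
Hypothesis A_full_row_rank : \rank A = m.
Hypothesis R_basis : orthonormal_basis R A.
Hypothesis Z_basis : orthonormal_basis Z (kermx A^T).
Hypothesis beta_gt0 : 0 < beta.

(** The scaled reduced Hessian: [M] is [Z (S + 1)^-1 Z^T], and [M_Z] is the reflected resolvent
    [2 (S + 1)^-1 - 1]. *)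
Let S := beta^-1 *: (Z^T *m Q *m Z).
Let M := M_mx Q beta Z.
Let kappa := specnorm (MZ_mx Q beta Z).

Lemma reduced_hessian_psd : psdmx S.
Proof.
move=> x; rewrite /S -scalemxAl dotZr mulr_ge0 ?invr_ge0 ?(ltW beta_gt0) //.
by rewrite -!mulmxA dot_mulmxr trmxK; apply: Qpsd.
Qed.

Lemma M_mxE : M = Z *m invmx (S + 1%:M) *m Z^T.
Proof.
rewrite /M /M_mx /S; congr (_ *m invmx _ *m _).
by rewrite mulmxDr mulmxDl mulmx1 Z_basis.1 -scalemxAr -scalemxAl.
Qed.

(** With [(S + 1) u = Z^T x] one has [M x = Z u], and [<M x, x> = <u, S u> + |u|^2]. *)
Lemma M_mx_firm x : dot (M *m x) (M *m x) <= dot (M *m x) x.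
Proof.
pose u := invmx (S + 1%:M) *m (Z^T *m x).
have ZxE : Z^T *m x = S *m u + u.
  rewrite -[X in _ + X]mul1mx -mulmxDl mulmxA mulmxV ?mul1mx //.
  exact: psd_add1_unit reduced_hessian_psd.
have -> : M *m x = Z *m u by rewrite M_mxE -!mulmxA.
have adj y : dot (Z *m u) y = dot u (Z^T *m y) by rewrite dot_mulmxr trmxK.
rewrite !adj mulmxA Z_basis.1 mul1mx ZxE dotDr lerDr; exact: reduced_hessian_psd.
Qed.

(** The optimality conditions make [(y*, lam*/beta)] a fixed point of the y-step. Stationarity
    replaces the multiplier term by [Q y*/beta] plus a vector in the range of [A^T], which [M]
    annihilates. *)
Lemma optimal_fixed_point Y ystar lamstar :
  optimal_with_multipliers Q q A b Y ystar lamstar ->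
  ystar = M *m (ystar + beta^-1 *: lamstar - beta^-1 *: q)
          + N_mx Q A beta R Z *m b.
Proof.
case=> xi [stat feas _].
set s := R^T *m ystar; set z := Z^T *m ystar.
have yE : ystar = R *m s + Z *m z.
  by rewrite (orthonormal_decomp A_full_row_rank R_basis Z_basis).
have bE : invmx (A *m R) *m b = s.
  rewrite -feas {1}yE mulmxDr mulmxA [A *m (Z *m _)]mulmxA.
  rewrite (mulmx_A_Z Z_basis) mul0mx addr0 mulmxA mulVmx ?mul1mx //.
  exact: AR_unit R_basis.
have residual : beta^-1 *: lamstar - beta^-1 *: q =
    beta^-1 *: (Q *m ystar) + beta^-1 *: (A^T *m xi).
  rewrite -scalerBr -scalerDr; congr (_ *: _).
  by rewrite -stat; apply/colP=> i; rewrite !mxE; ring.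
have ZA : Z^T *m A^T = 0 by rewrite -trmx_mul (mulmx_A_Z Z_basis) trmx0.
have MA : M *m (beta^-1 *: (A^T *m xi)) = 0.
  by rewrite M_mxE -scalemxAr -!mulmxA [Z^T *m (A^T *m xi)]mulmxA ZA !(mul0mx, mulmx0) scaler0.
have MR : M *m (R *m s) = 0.
  rewrite M_mxE -!mulmxA [Z^T *m (R *m s)]mulmxA.
  by rewrite -[Z^T *m R]trmxK trmx_mul trmxK (mulmx_RT_Z R_basis Z_basis)
    trmx0 !(mul0mx, mulmx0).
(* On the range of [Z], [M] inverts [1 + Q/beta] compressed to that subspace. *)
have MZz : M *m (Z *m z) + M *m (beta^-1 *: Q *m (Z *m z)) = Z *m z.
  rewrite M_mxE -!mulmxA -!mulmxDr; congr (Z *m _).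
  have -> : Z^T *m (Z *m z + beta^-1 *: Q *m (Z *m z)) = (S + 1%:M) *m z.
    rewrite mulmxDr mulmxDl mul1mx addrC /S [Z^T *m (Z *m z)]mulmxA Z_basis.1 mul1mx.
    by rewrite -!scalemxAl -scalemxAr -!mulmxA.
  by rewrite mulmxA mulVmx ?mul1mx //; apply: psd_add1_unit reduced_hessian_psd.
have Nb : N_mx Q A beta R Z *m b = R *m s - M *m (beta^-1 *: Q *m (R *m s)).
  by rewrite /N_mx -/M -!mulmxA bE mulmxBl mul1mx -!mulmxA.
have My : M *m (ystar + beta^-1 *: lamstar - beta^-1 *: q) =
    Z *m z + M *m (beta^-1 *: Q *m (R *m s)).
  rewrite -addrA residual !mulmxDr MA addr0 scalemxAl yE !mulmxDr MR add0r.
  by rewrite addrCA MZz addrC.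
by rewrite Nb My {1}yE addrACA subrr addr0 addrC.
Qed.

(** With [t = M (a + l)], the difference of squares is [|a - t|^2 + 2 (<t, a + l> - |t|^2)],
    nonnegative by firmness. *)
Lemma M_step_nonexpansive a l :
  enorm (M *m (a + l) - l) <= enorm (col_mx a l).
Proof.
rewrite enorm_le dot_col_mx; move: (M_mx_firm (a + l)).
set t := M *m (a + l); have := dot_ge0 (a - t).
rewrite !dot_linE ?(dotC a t) ?(dotC l t) ?(dotC l a); lra.
Qed.

(** * One step of the error recursion, for abstract [e] and [p] *)

Section Step.
Variables e p : 'cV[K]_n.
Hypothesis p_firm : dot p p <= dot p e.
Let e' := M *m (p + p - e) + e - p.

(** The range of [M] is orthogonal to [R], which leaves [R^T (e - p)]. On the [Z] side, use
    [2 (S + 1)^-1 = M_Z + 1] and [2 (e - p) = e - d]. *)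
Lemma step_split :
  enorm e' ^+ 2 = 4^-1 * (enorm (MZ_mx Q beta Z *m (Z^T *m (p + p - e)) + Z^T *m e) ^+ 2
                        + enorm (2 *: (R^T *m (e - p))) ^+ 2).
Proof.
have -> : MZ_mx Q beta Z *m (Z^T *m (p + p - e)) + Z^T *m e = 2 *: (Z^T *m e').
  rewrite /MZ_mx -/S mulmxBl mul1mx -scalemxAl.
  have -> : Z^T *m e' = invmx (S + 1%:M) *m (Z^T *m (p + p - e)) + Z^T *m (e - p).
    by rewrite /e' -addrA mulmxDr M_mxE !mulmxA Z_basis.1 mul1mx.
  by rewrite !mulmxDr !mulmxN; apply/colP=> i; rewrite !mxE; ring.
have -> : R^T *m (e - p) = R^T *m e'.
  apply/esym; rewrite /e' -addrA mulmxDr M_mxE !mulmxA (mulmx_RT_Z R_basis Z_basis).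
  by rewrite !mul0mx add0r.
rewrite !enormZ !exprMn !sqr_enorm (dot_splitting A_full_row_rank R_basis Z_basis e').
by rewrite real_normK ?num_real //; field.
Qed.

Lemma step_contraction c amax :
  enorm (R^T *m (e - p)) <= c * enorm (e - p) ->
  enorm (e - p) <= amax * enorm e ->
  enorm e' <= delta kappa c amax * enorm e.
Proof.
move=> hc ha; have kappa_ge0 : 0 <= kappa by exact: specnorm_ge0.
(* The rescaling divides by [|e|], so [e = 0] is treated apart. *)
have [e0|e0] := eqVneq e 0.
  have p0 : p = 0.
    apply/eqP; rewrite -dot_eq0 eq_le dot_ge0 andbT.
    by rewrite (le_trans p_firm) // e0 /dot mulmx0 mxE.
  rewrite /e' e0 p0 !(subr0, addr0) mulmx0 (_ : enorm _ = 0) ?mulr0 //.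
  by apply/eqP; rewrite enorm_eq0.
have e_gt0 : 0 < enorm e by rewrite lt0r enorm_eq0 e0 enorm_ge0.
set d := p + p - e.
have d_le : dot d d <= dot e e.
  by rewrite /d !dot_linE !(dotC e p); move: p_firm; lra.
have splitZ x : dot x x <= dot e e ->
    0 <= enorm (Z^T *m x) <= enorm e /\
    enorm (R^T *m x) <= Num.sqrt (enorm e ^+ 2 - enorm (Z^T *m x) ^+ 2).
  rewrite (dot_splitting A_full_row_rank R_basis Z_basis x) => xe.
  rewrite enorm_ge0 enorm_le enormE !sqr_enorm; split.
    by rewrite (le_trans _ xe) // lerDr dot_ge0.
  by apply: ler_wsqrtr; move: xe; lra.
have [dZ dR] := splitZ d d_le; have [eZ eR] := splitZ e (lexx _).
have two_ep : 2 *: (e - p) = e - d.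
  by rewrite /d; apply/colP=> i; rewrite !mxE; ring.
have norm2 k (x : 'cV[K]_k) : enorm (2 *: x) = 2 * enorm x.
  by rewrite enormZ ger0_norm.
rewrite -ler_sqr ?nnegrE ?mulr_ge0 ?enorm_ge0 ?delta_ge0 // step_split.
apply: le_trans (le_delta_scaled (a := enorm (e - p)) (g := 2 * enorm (R^T *m (e - p)))
  kappa_ge0 e_gt0 _ _ _ dZ eZ _).
(* Objective: the triangle inequality and the definition of [kappa]. *)
- rewrite ler_pM2l ?invr_gt0 // norm2 lerD2r.
  rewrite ler_sqr ?nnegrE ?addr_ge0 ?mulr_ge0 ?enorm_ge0 //.
  by rewrite (le_trans (enormD _ _)) // lerD2r enorm_mulmx_le.
(* First constraint: [2 Z^T (e - p) = Z^T e - Z^T d], while by Pythagoras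
   [|Z^T (e - p)|^2 >= (1 - c^2) |e - p|^2]. *)
- have : enorm (2 *: (Z^T *m (e - p))) ^+ 2 <= (enorm (Z^T *m d) + enorm (Z^T *m e)) ^+ 2.
    rewrite ler_sqr ?nnegrE ?addr_ge0 ?enorm_ge0 //.
    by rewrite scalemxAr two_ep mulmxBr [leRHS]addrC enormB.
  apply: le_trans; rewrite norm2 exprMn.
  have : enorm (R^T *m (e - p)) ^+ 2 <= (c * enorm (e - p)) ^+ 2.
    by rewrite ler_sqr ?nnegrE ?enorm_ge0 // (le_trans _ hc) ?enorm_ge0.
  have := dot_splitting A_full_row_rank R_basis Z_basis (e - p).
  rewrite -!sqr_enorm exprMn; lra.
- have : enorm (R^T *m (e - p)) ^+ 2 <= (c * enorm (e - p)) ^+ 2.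
    by rewrite ler_sqr ?nnegrE ?enorm_ge0 // (le_trans _ hc) ?enorm_ge0.
  by rewrite !exprMn; lra.
(* Third constraint: [2 R^T (e - p) = R^T e - R^T d], both terms bounded by [dR] and [eR]. *)
- rewrite mulr_ge0 ?enorm_ge0 //= -norm2 scalemxAr two_ep mulmxBr.
  by rewrite (le_trans (enormB _ _)) // addrC lerD.
- by rewrite enorm_ge0.
Qed.

(** Nonexpansiveness of a Douglas-Rachford step: with [t = M d], the two firmness inequalities give
    [|e|^2 - |e'|^2 >= |t - p|^2]. It keeps all errors below [Delta0]. *)
Lemma step_nonexpansive : enorm e' <= enorm e.
Proof.
have := p_firm; have := M_mx_firm (p + p - e).
rewrite enorm_le /e'; set t := M *m _; have := dot_ge0 (t - p).
rewrite !dot_linE ?(dotC e t) ?(dotC p t) ?(dotC e p); lra.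
Qed.

End Step.
End Iteration.

(** * Assembly: error recursion, case distinction on clipping, both bounds *)

Theorem theorem3 (K : realType) (m n : nat)
    (Q : 'M[K]_n) (q : 'cV[K]_n) (A : 'M[K]_(m, n)) (b : 'cV[K]_m)
    (lo hi : 'I_n -> \bar K)
    (R : 'M[K]_(n, m)) (Z : 'M[K]_(n, n - m)) (beta : K)
    (ystar lamstar : 'cV[K]_n) (y w lam : nat -> 'cV[K]_n)
    (Qsym : Q^T = Q) (Qpsd : psdmx Q)
    (lo_lt_hi : forall i, (lo i < hi i)%E)
    (Y_neq0 : box lo hi !=set0)
    (A_full_row_rank : \rank A = m)
    (R_basis : orthonormal_basis R A)
    (Z_basis : orthonormal_basis Z (kermx A^T))
    (beta_gt0 : 0 < beta)
    (ZQZ_pd : pdmx (Z^T *m Q *m Z))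
    (ystar_opt : optimal_with_multipliers Q q A b (box lo hi) ystar lamstar)
    (RE_full_col_rank :
       \rank (row_mx R (unit_columns K (active lo hi ystar)))
       = (m + #|active lo hi ystar|)%N)
    (y_step : forall k, y k.+1 =
       M_mx Q beta Z *m (w k + lam k - beta^-1 *: q)
       + N_mx Q A beta R Z *m b)
    (w_step : forall k, w k.+1 = euclidean_proj (box lo hi) (y k.+1 - lam k))
    (lam_step : forall k, lam k.+1 = lam k + w k.+1 - y k.+1) :
  let v := fun k : nat => y k.+1 - lam k in
  let vstar := ystar - beta^-1 *: lamstar in
  let cF := specnorm (R^T *m unit_columns K (active lo hi ystar)) in
  let kappa := specnorm (MZ_mx Q beta Z) in
  let Delta0 := enorm (v 0%N - vstar) in
  let deltaG := Num.max (delta kappa cF 1)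
                        (delta kappa 1 (alpha_max lo hi ystar Delta0)) in
  forall k : nat,
    enorm (v k.+1 - vstar) <= deltaG * enorm (v k - vstar) /\
    enorm (col_mx (w k.+2) (lam k.+2) - col_mx ystar (beta^-1 *: lamstar))
    <= deltaG *
       enorm (col_mx (w k) (lam k) - col_mx ystar (beta^-1 *: lamstar)).
Proof.
move=> v vstar cF kappa Delta0 deltaG.
set proj := euclidean_proj (box lo hi).
have [xi [_ _ [box_ystar perp_lam]]] := ystar_opt.
have fixed := optimal_fixed_point Qpsd A_full_row_rank R_basis Z_basis beta_gt0 ystar_opt.
(* As [v* - y* = -lam*/beta], complementarity is the variational inequality at [y*]. *)
have proj_star : proj vstar = ystar.
  apply: euclidean_proj_eq => // z /perp_lam.
  rewrite /vstar addrAC subrr add0r dotNl dotZl oppr_le0 => lam_z.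
  by rewrite mulr_ge0 ?invr_ge0 ?(ltW beta_gt0).
(* Indices shift here: [e k] is determined by [(w k, lam k)], while [p k] is the error of
   [w k.+1]. *)
pose e k : 'cV[K]_n := v k - vstar; pose p k : 'cV[K]_n := proj (v k) - ystar.
have firm k : dot (p k) (p k) <= dot (p k) (e k).
  by rewrite /p -proj_star; apply: euclidean_proj_box_firm.
have wE k : w k.+1 - ystar = p k by rewrite w_step.
have lamE k : lam k.+1 - beta^-1 *: lamstar = p k - e k.
  rewrite lam_step w_step /p /e /vstar -/(v k) -/proj.
  by apply/colP=> i; rewrite !mxE; ring.
have yE k : y k.+1 - ystar =
    M_mx Q beta Z *m ((w k - ystar) + (lam k - beta^-1 *: lamstar)).
  rewrite y_step {1}fixed; rewrite opprD addrACA subrr addr0 -mulmxBr.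
  by congr (_ *m _); apply/colP=> i; rewrite !mxE; ring.
have vE k : e k = M_mx Q beta Z *m ((w k - ystar) + (lam k - beta^-1 *: lamstar))
                  - (lam k - beta^-1 *: lamstar).
  by rewrite -yE /e /v /vstar; apply/colP=> i; rewrite !mxE; ring.
have step k : e k.+1 = M_mx Q beta Z *m (p k + p k - e k) + e k - p k.
  by rewrite vE wE lamE addrA; move: (e k) => ek; rewrite opprB addrA.
(* This lets [alpha_max], evaluated at the initial error, serve at every [k]. *)
have e_le0 k : enorm (e k) <= enorm (e 0%N).
  elim: k => // k; apply: le_trans; rewrite step.
  by have := step_nonexpansive Qpsd Z_basis beta_gt0 (firm k).
have contraction k : enorm (e k.+1) <= deltaG * enorm (e k).
  rewrite step.
  pose S := active lo hi ystar.
  have vstar_inactive i : i \notin S -> ystar i 0 = vstar i 0.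
    by move=> iS; rewrite -proj_star (proj_notin_active lo_lt_hi) // -/proj proj_star.
  have norm_le : dot (e k - p k) (e k - p k) + dot (p k) (p k) <= dot (e k) (e k).
    exact: firm_pythagoras.
  case: (pselect (forall i, i \notin S -> proj (v k) i 0 = v k i 0)) => [inact|].
    apply: (@le_trans _ _ (delta kappa cF 1 * enorm (e k))).
      apply: (step_contraction Q beta A_full_row_rank R_basis Z_basis (firm k)).
        apply: enorm_mulmx_unit_columns => i iS.
        have coordE (s t u z : 'cV[K]_n) :
            (s - t - (u - z)) i 0 = (s i 0 - u i 0) - (t i 0 - z i 0).
          by rewrite !mxE; ring.
        by rewrite /e /p coordE inact // vstar_inactive // !subrr.
      by rewrite mul1r enorm_le (le_trans _ norm_le) // lerDl dot_ge0.
    by rewrite ler_wpM2r ?enorm_ge0 // /deltaG le_max lexx.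
  move=> /existsNP[i /not_implyP[iS /eqP clipped]].
  apply: (@le_trans _ _ (delta kappa 1 (alpha_max lo hi ystar Delta0) * enorm (e k))).
    apply: (step_contraction Q beta A_full_row_rank R_basis Z_basis (firm k)).
      by rewrite mul1r enorm_le (dot_splitting A_full_row_rank R_basis Z_basis (e k - p k)) lerDl dot_ge0.
    have gap_le : (gap_min lo hi ystar <= (enorm (p k))%:E)%E.
      by rewrite /p -proj_star (gap_min_le_enorm lo_lt_hi (i := i)) // -/proj proj_star.
    have p_le : enorm (p k) <= enorm (e k).
      by rewrite enorm_le (le_trans _ norm_le) // lerDr dot_ge0.
    have e_le : enorm (e k) <= Delta0 by exact: e_le0.
    rewrite /alpha_max ifT; last first.
      by rewrite (le_trans gap_le) // lee_fin (le_trans p_le).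
    have := gap_min_ge0 box_ystar; move: gap_le.
    (* Only a finite gap survives: [gap_le] excludes [+oo] and nonnegativity excludes [-oo]. *)
    case: (gap_min lo hi ystar) => [g| |] //=; rewrite !lee_fin => gap_le g0.
    rewrite -(ger0_norm (enorm_ge0 (e k))) -[`|_|]sqrtr_sqr -sqrtrM; last first.
      rewrite subr_ge0 expr_le1 ?divr_ge0 ?enorm_ge0 //.
      (* If [Delta0 = 0], the quotient is 0 by the convention for inverses. *)
      have [D0|D0] := eqVneq Delta0 0; first by rewrite D0 invr0 mulr0.
      rewrite ler_pdivrMr ?mul1r ?lt0r ?D0 ?enorm_ge0 //.
      by rewrite (le_trans gap_le) // (le_trans p_le).
    rewrite enormE; apply: ler_wsqrtr.
    (* Since [|e| <= Delta0], [(g / Delta0) |e| <= g <= |p|]; then [|e - p|^2 <= |e|^2 - |p|^2]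
       yields the factor [1 - (g / Delta0)^2]. *)
    have : (g / Delta0 * enorm (e k)) ^+ 2 <= enorm (p k) ^+ 2.
      rewrite ler_sqr ?nnegrE ?mulr_ge0 ?invr_ge0 ?enorm_ge0 //.
      rewrite (le_trans _ gap_le) // -mulrA ler_piMr //.
      have [->|D0] := eqVneq Delta0 0; first by rewrite invr0 mul0r.
      by rewrite mulrC ler_pdivrMr ?mul1r // lt0r D0 enorm_ge0.
    by rewrite exprMn !sqr_enorm; move: norm_le; lra.
  by rewrite ler_wpM2r ?enorm_ge0 // /deltaG le_max lexx orbT.
move=> k; split; first exact: contraction.
have deltaG_ge0 : 0 <= deltaG by rewrite le_max delta_ge0.
rewrite !opp_col_mx !add_col_mx wE lamE.
(* The error of [(w k.+2, lam k.+2)] is [(p, p - e)] at index [k.+1]; one contraction then leads to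
   [e k], which is bounded by the error of [(w k, lam k)]. *)
apply: (@le_trans _ _ (enorm (e k.+1))).
  rewrite enorm_le dot_col_mx addrC -opprB dotNl dotNr opprK.
  exact: firm_pythagoras.
apply: (le_trans (contraction k)); apply: ler_wpM2l => //.
by rewrite vE (M_step_nonexpansive Qpsd Z_basis beta_gt0).
Qed.
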